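(* Let $\Omega_0\subset\mathbb{R}^2$ be an object with signed distance function $\phi:\mathbb{R}^2\to\mathbb{R}$, and for each $c\in\mathbb{R}$ let $\Omega_c=\{x\in\mathbb{R}^2 : \phi(x)\le c\}$ be the $c$-sublevel set of $\phi$. Then $\Omega_0$ is convex if and only if $\Omega_c$ is convex for all $c\in\mathbb{R}$.
   Context: An object $\Omega_0\subset\mathbb{R}^2$ is a nonempty closed proper subset of the plane, with boundary $C=\partial\Omega_0$. For $x\in\mathbb{R}^2$ put $\mathrm{dist}(x,C)=\min_{y\in C}\|x-y\|_2$. The signed distance function of $\Omega_0$ is $$\phi(x)=\begin{cases}-\mathrm{dist}(x,C), & x \text{ inside } C \ (\text{i.e. } x\in\Omega_0),\\ \ \ \mathrm{dist}(x,C), & x\text{ outside } C\ (\text{i.e. } x\notin\Omega_0).\end{cases}$$ In particular $\Omega_0=\{x:\phi(x)\le 0\}$ and $C=\{x:\phi(x)=0\}$, so the set $\Omega_c$ with $c=0$ is $\Omega_0$ itself. The empty set is regarded as convex. *)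

(* Defs.v *)
From mathcomp Require Import all_boot all_order all_algebra.
From mathcomp Require Import all_classical all_reals all_analysis.

Set Implicit Arguments.
Unset Strict Implicit.
Unset Printing Implicit Defensive.

Import Order.TTheory GRing.Theory Num.Theory.
Import numFieldNormedType.Exports.

Local Open Scope classical_set_scope.
Local Open Scope ring_scope.

(* The library's norm `|x| on row vectors is the sup norm; it induces the
   Euclidean topology, but metric notions must go through the 2-norm. *)
Definition norm2 (R : realType) (x : 'rV[R]_2) : R :=
  Num.sqrt (\sum_(i < 2) x ord0 i ^+ 2).

Definition boundary (T : topologicalType) (A : set T) : set T :=
  closure A `\` A°.

(* For C closed and nonempty the infimum is a minimum: see [dist_attained]. *)
Definition dist (R : realType) (x : 'rV[R]_2) (C : set 'rV[R]_2) : R :=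
  inf [set norm2 (x - y) | y in C].

Definition sdf (R : realType) (Omega : set 'rV[R]_2) (x : 'rV[R]_2) : R :=
  if x \in Omega then - dist x (boundary Omega) else dist x (boundary Omega).

Definition sublevel (R : realType) (T : Type) (f : T -> R) (c : R) : set T :=
  [set x | f x <= c].

Lemma norm2E (R : realType) (x : 'rV[R]_2) :
  norm2 x = Num.sqrt (x ord0 ord0 ^+ 2 + x ord0 (lift ord0 ord0) ^+ 2).
Proof. by rewrite /norm2 !big_ord_recl big_ord0 addr0. Qed.

Lemma norm2_continuous (R : realType) : continuous (@norm2 R).
Proof.
rewrite (_ : @norm2 R = fun x => Num.sqrt (x ord0 ord0 * x ord0 ord0 +
    x ord0 (lift ord0 ord0) * x ord0 (lift ord0 ord0))); last first.
  by apply/funext => x; rewrite norm2E !expr2.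
move=> x.
apply: (continuous_comp
  (f := fun x : 'rV[R]_2 => x ord0 ord0 * x ord0 ord0 +
    x ord0 (lift ord0 ord0) * x ord0 (lift ord0 ord0))); last first.
  exact: sqrt_continuous.
have cM i : {for x, continuous (fun y : 'rV[R]_2 => y ord0 i * y ord0 i)}.
  have ci : {for x, continuous (fun y : 'rV[R]_2 => y ord0 i)}.
    exact: (@coord_continuous R 1 2 ord0 i x).
  exact: (cvgM ci ci).
exact: (cvgD (cM ord0) (cM (lift ord0 ord0))).
Qed.

Lemma normr_le_norm2 (R : realType) (x : 'rV[R]_2) : `|x| <= norm2 x.
Proof.
rewrite [leLHS]/Num.norm /= mx_normrE.
apply: bigmax_le => [|[i j] _]; first exact: sqrtr_ge0.
rewrite ord1 /= -sqrtr_sqr ler_wsqrtr// (bigD1 j)//= lerDl.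
by apply: sumr_ge0 => k _; exact: sqr_ge0.
Qed.

Lemma dist_attained (R : realType) (x : 'rV[R]_2) (C : set 'rV[R]_2) :
  closed C -> C !=set0 ->
  exists y, [/\ C y, dist x C = norm2 (x - y) &
                forall z, C z -> norm2 (x - y) <= norm2 (x - z)].
Proof.
move=> clC [y0 Cy0].
have cf : continuous (fun y : 'rV[R]_2 => norm2 (x - y)).
  move=> y; apply: (continuous_comp (f := fun y : 'rV[R]_2 => x - y)).
    exact: (cvgB (@cvg_cst _ x _ (nbhs y) _) (@cvg_id _ (nbhs y))).
  exact: norm2_continuous.
pose K := C `&` [set y | norm2 (x - y) <= norm2 (x - y0)].
have cK : compact K.
  apply: bounded_closed_compact.
    exists (`|x| + norm2 (x - y0)); split; first exact: num_real.
    move=> M ltM y [_ yle] /=; apply: le_trans (ltW ltM).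
    rewrite (_ : y = x - (x - y)); last by rewrite subKr.
    apply: le_trans (ler_normB _ _) _; rewrite lerD2l.
    exact: le_trans (normr_le_norm2 _) yle.
  apply: closedI => //.
  exact: (preimage_closed (fun y _ => cf y) (@closed_le _ (norm2 (x - y0)))).
have K0 : K !=set0 by exists y0; split => //=.
have [y /[!inE] -[Cy yle] ymin] := EVT_min_rV K0 cK (continuous_subspaceT cf).
have minC z : C z -> norm2 (x - y) <= norm2 (x - z).
  move=> Cz; have [le0|/ltW gt0] := leP (norm2 (x - z)) (norm2 (x - y0)).
    by apply: ymin; rewrite inE; split.
  exact: le_trans yle gt0.
exists y; split => //; apply/eqP; rewrite eq_le; apply/andP; split.
  apply: ge_inf; last by exists y.
  by exists 0 => _ [z _ <-]; exact: sqrtr_ge0.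
apply: lb_le_inf; first by exists (norm2 (x - y)), y.
by move=> _ [z Cz <-]; exact: minC.
Qed.

(* Main.v *)
(* Segments from a point of the closed set A to a point outside A meet the
   boundary, so the distance to the boundary measures how far one must travel to
   enter or leave A. Hence for c >= 0 the c-sublevel set of the signed distance
   is the closed c-neighbourhood of A, and for c < 0 it is the set of centres of
   open balls of radius -c contained in A; both constructions preserve
   convexity. Conversely the 0-sublevel set is A. *)

Require Import Defs.
From mathcomp Require Import all_boot all_order all_algebra.
From mathcomp Require Import all_classical all_reals all_analysis.
From mathcomp Require Import ring lra.

Set Implicit Arguments.
Unset Strict Implicit.
Unset Printing Implicit Defensive.

Import Order.TTheory GRing.Theory Num.Theory.
Import numFieldNormedType.Exports.

Local Open Scope classical_set_scope.
Local Open Scope ring_scope.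

Lemma conv_lmodE (R : numDomainType) (E : lmodType R) (l : {i01 R})
    (x y : convex_lmodType E) :
  conv l x y = l%:num *: (x : E) + (1 - l%:num) *: (y : E) :> E.
Proof. by []. Qed.

Lemma norm2_ge0 (R : realType) (x : 'rV[R]_2) : 0 <= norm2 x.
Proof. exact: sqrtr_ge0. Qed.

Lemma norm2_sqr (R : realType) (x : 'rV[R]_2) :
  norm2 x ^+ 2 = x ord0 ord0 ^+ 2 + x ord0 (lift ord0 ord0) ^+ 2.
Proof. by rewrite norm2E sqr_sqrtr// addr_ge0// sqr_ge0. Qed.

Lemma norm2D (R : realType) (x y : 'rV[R]_2) :
  norm2 (x + y) <= norm2 x + norm2 y.
Proof.
have x0 := norm2_ge0 x; have y0 := norm2_ge0 y.
rewrite -(@ler_pXn2r _ 2)// ?nnegrE ?norm2_ge0 ?addr_ge0//.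
rewrite sqrrD !norm2_sqr !mxE.
set a := x _ _; set b := x _ _; set c := y _ _; set d := y _ _.
(* After squaring, only the Cauchy-Schwarz inequality is left. It follows from Lagrange's identity:
   the difference of the two squared sides is [(a * d - b * c) ^+ 2]. *)
suff : a * c + b * d <= norm2 x * norm2 y by lra.
apply: le_trans (ler_norm _) _.
rewrite -(@ler_pXn2r _ 2)// ?nnegrE ?mulr_ge0//.
rewrite real_normK ?num_real// exprMn !norm2_sqr -/a -/b -/c -/d.
have := sqr_ge0 (a * d - b * c); lra.
Qed.

Lemma norm2Z (R : realType) (k : R) (x : 'rV[R]_2) :
  norm2 (k *: x) = `|k| * norm2 x.
Proof. by rewrite !norm2E !mxE !exprMn -mulrDr sqrtrM ?sqr_ge0// sqrtr_sqr. Qed.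

Lemma norm2_0 (R : realType) : norm2 (0 : 'rV[R]_2) = 0.
Proof. by rewrite -[X in norm2 X](scale0r 0) norm2Z normr0 mul0r. Qed.

Lemma norm2_eq0 (R : realType) (x : 'rV[R]_2) : norm2 x = 0 -> x = 0.
Proof.
by move=> x0; apply/eqP; rewrite -normr_le0 -x0; exact: normr_le_norm2.
Qed.

(** The topology comes from the sup norm, so openness of Euclidean balls is derived from continuity
    of [norm2]. It places a ball contained in a set inside the interior of that set. *)
Lemma open_ball2 (R : realType) (x : 'rV[R]_2) (r : R) :
  open [set w | norm2 (x - w) < r].
Proof.
have cf : continuous (fun w : 'rV[R]_2 => norm2 (x - w)).
  move=> w; apply: (continuous_comp (f := fun y : 'rV[R]_2 => x - y)).
    exact: (cvgB (@cvg_cst _ x _ (nbhs w) _) (@cvg_id _ (nbhs w))).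
  exact: norm2_continuous.
exact: (open_comp (fun w _ => cf w) (@open_lt _ r)).
Qed.

Lemma boundary_closed (T : topologicalType) (A : set T) : closed (boundary A).
Proof.
rewrite /boundary setDE; apply: closedI; first exact: closed_closure.
exact/open_closedC/open_interior.
Qed.

Lemma boundary_sub (T : topologicalType) (A : set T) :
  closed A -> boundary A `<=` A.
Proof. by move=> /closure_id {2}-> x []. Qed.

(* Otherwise the segment's trace on [A] would be relatively clopen. *)
Lemma segment_meets_boundary (R : realType) (V : normedModType R) (A : set V)
    (a b : V) : closed A -> A a -> ~ A b ->
  exists2 t : R, 0 <= t <= 1 & boundary A (a + t *: (b - a)).
Proof.
move=> clA Aa nAb; apply: contrapT => nobd.
pose p (t : R) := a + t *: (b - a).
have cp : continuous p.
  move=> t; apply: cvgD; first exact: cvg_cst.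
  exact: (@cvgZr_tmp _ _ _ _ _ _ _ _ (@cvg_id _ _)).
have intA t : t \in `[0, 1] -> A (p t) -> A° (p t).
  move=> t01 Apt; apply: contrapT => nint; apply: nobd; exists t.
    by move: t01; rewrite in_itv.
  by split => //; exact: subset_closure.
have p0 : p 0 = a by rewrite /p scale0r addr0.
have p1 : p 1 = b by rewrite /p scale1r addrC subrK.
suff eqI : `[0, 1] `&` p @^-1` A = `[0, 1]%classic.
  have : (`[0, 1] `&` p @^-1` A) 1 by rewrite eqI /= in_itv /= ler01 lexx.
  by case=> _ /=; rewrite p1.
apply: (@segment_connected R 0 1).
- by exists 0; split; rewrite /= ?p0// in_itv /= lexx ler01.
- exists (p @^-1` A°).
    by apply: open_comp => [t _|]; [exact: cp|exact: open_interior].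
  apply/seteqP; split => t [t01 At]; split => //; first exact: intA.
  exact: interior_subset At.
- by exists (p @^-1` A) => //; apply: preimage_closed => // t _; exact: cp.
Qed.

Section signed_distance.
Context {R : realType} (A : set 'rV[R]_2).
Hypotheses (clA : closed A) (A0 : A !=set0) (AT : A <> setT).

(** Ensures that the infimum in [dist] ranges over a nonempty set, hence is attained on the closed
    boundary. *)
Lemma boundary_neq0 : boundary A !=set0.
Proof.
have [a Aa] := A0; have [b nAb] : exists b, ~ A b.
  by apply/existsNP => allA; apply: AT; apply/seteqP; split.
by have [t _ bt] := segment_meets_boundary clA Aa nAb; exists (a + t *: (b - a)).
Qed.

Lemma dist_boundary_le (x y : 'rV[R]_2) :
  boundary A y -> dist x (boundary A) <= norm2 (x - y).
Proof.
move=> By.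
have [w [_ -> wmin]] := dist_attained x (@boundary_closed _ A) boundary_neq0.
exact: wmin.
Qed.

Lemma dist_boundary_ge0 (x : 'rV[R]_2) : 0 <= dist x (boundary A).
Proof.
have [w [_ -> _]] := dist_attained x (@boundary_closed _ A) boundary_neq0.
exact: norm2_ge0.
Qed.

(** A boundary point on the segment from [x] to [y] is at distance [t * norm2 (x - y)] from [x],
    with [t <= 1]. Stating the hypothesis as [A x <> A y] covers both entering and leaving [A]. *)
Lemma dist_boundary_crossing (x y : 'rV[R]_2) :
  A x <> A y -> dist x (boundary A) <= norm2 (x - y).
Proof.
move=> Axy.
suff [t /andP[t0 t1] bt] : exists2 t : R, 0 <= t <= 1 &
    boundary A (x + t *: (y - x)).
  apply: le_trans (dist_boundary_le _ bt) _.
  rewrite opprD addrA subrr add0r -scalerN opprB norm2Z ger0_norm//.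
  by rewrite ler_piMl// norm2_ge0.
have [Ax|nAx] := pselect (A x).
  apply: segment_meets_boundary => // Ay.
  by apply: Axy; apply/propext; split.
have Ay : A y by apply: contrapT => nAy; apply: Axy; apply/propext; split.
(* The crossing lemma starts from the endpoint in [A], here [y], so the parameter has to be
   reversed. *)
have [t /andP[t0 t1] bt] := segment_meets_boundary clA Ay nAx.
exists (1 - t); first by apply/andP; split; lra.
suff -> : x + (1 - t) *: (y - x) = y + t *: (x - y) by [].
by apply/rowP => i; rewrite !mxE; ring.
Qed.

Lemma sublevel_sdf_ge0 (c : R) : 0 <= c ->
  sublevel (sdf A) c = [set x | exists2 y, A y & norm2 (x - y) <= c].
Proof.
move=> c0; apply/seteqP; split => x; rewrite /sublevel /sdf /=.
  case: ifPn => [/set_mem Ax _|_ dc].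
    by exists x => //; rewrite subrr norm2_0.
  (* The nearest boundary point serves as witness: it lies in [A] because [A] is closed. *)
  have [w [Bw dw _]] := dist_attained x (@boundary_closed _ A) boundary_neq0.
  by exists w; [exact: boundary_sub Bw|rewrite -dw].
move=> [y Ay xyc]; case: ifPn => [_|/negP nAx].
  by apply: le_trans c0; rewrite oppr_le0 dist_boundary_ge0.
apply: le_trans xyc; apply: dist_boundary_crossing => Axy.
by apply: nAx; rewrite inE Axy.
Qed.

Lemma sublevel_sdf_lt0 (c : R) : c < 0 ->
  sublevel (sdf A) c = [set x | [set w | norm2 (x - w) < - c] `<=` A].
Proof.
move=> c0; apply/seteqP; split => x; rewrite /sublevel /sdf /=.
  case: ifPn => [/set_mem Ax dc w /= xw|_ dc].
    apply: contrapT => nAw.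
    have : dist x (boundary A) <= norm2 (x - w).
      by apply: dist_boundary_crossing => Axw; apply: nAw; rewrite -Axw.
    by lra.
  by have := dist_boundary_ge0 x; lra.
move=> ballA.
have Ax : A x by apply: ballA => /=; rewrite subrr norm2_0; lra.
rewrite mem_set// lerNl leNgt; apply/negP.
(* If the nearest boundary point [w] were closer than [- c], it would lie in an open ball contained
   in [A], hence in the interior of [A], which no boundary point does. *)
have [w [[_ nintw] -> _]] :=
  dist_attained x (@boundary_closed _ A) boundary_neq0.
move=> xw; apply: nintw; move: ballA.
by rewrite (open_subsetE _ (@open_ball2 R x (- c))); apply.
Qed.

Lemma sublevel_sdf0 : sublevel (sdf A) 0 = A.
Proof.
rewrite sublevel_sdf_ge0//; apply/seteqP; split => [x [y Ay xy]|x Ax] /=.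
  suff -> : x = y by [].
  apply/eqP; rewrite -subr_eq0; apply/eqP/norm2_eq0/eqP.
  by rewrite eq_le xy norm2_ge0.
by exists x => //; rewrite subrr norm2_0.
Qed.

Lemma convex_sublevel_sdf (c : R) :
  convex_set A -> convex_set (sublevel (sdf A) c).
Proof.
move=> cvxA; have [c0|c0] := leP 0 c.
  rewrite sublevel_sdf_ge0// => x y l /set_mem[x' Ax' xx'] /set_mem[y' Ay' yy'].
  (* Combining the two nearby points of [A] with the same weight keeps the error at most [c], by the
     triangle inequality. *)
  apply/mem_set; exists (conv l (x' : convex_lmodType _) y').
    by apply/set_mem/cvxA; exact/mem_set.
  have l0 : 0 <= l%:num by [].
  have l1 : 0 <= 1 - l%:num by rewrite subr_ge0.
  have -> : (conv l x y : 'rV[R]_2) - conv l (x' : convex_lmodType _) y' =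
      l%:num *: (x - x' : 'rV[R]_2) + (1 - l%:num) *: (y - y' : 'rV[R]_2).
    by rewrite !conv_lmodE; apply/rowP => i; rewrite !mxE; ring.
  apply: le_trans (norm2D _ _) _; rewrite !norm2Z !ger0_norm//.
  have -> : c = l%:num * c + (1 - l%:num) * c by ring.
  by apply: lerD; apply: ler_wpM2l.
rewrite sublevel_sdf_lt0// => x y l /set_mem xA /set_mem yA.
apply/mem_set => w /= zw.
(* The offset [v] of [w] from the combined centre is shorter than [- c], so [x + v] and [y + v] stay
   in their balls and thus in [A]; [w] is their convex combination with weight [l]. *)
pose v : 'rV[R]_2 := w - (conv l x y : 'rV[R]_2).
have Av u : [set w | norm2 (u - w) < - c] `<=` A -> A (u + v).
  move=> uA; apply: uA => /=.
  by rewrite opprD addrA subrr add0r /v opprB.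
suff -> : w = conv l (x + v : convex_lmodType _) (y + v : convex_lmodType _).
  by apply/set_mem/cvxA; apply/mem_set; exact: Av.
have -> : w = (conv l x y : 'rV[R]_2) + v by rewrite /v addrC subrK.
by rewrite !conv_lmodE; apply/rowP => i; rewrite !mxE; ring.
Qed.

End signed_distance.

Theorem lemma1 (R : realType) (Omega0 : set 'rV[R]_2)
    (Omega0_closed : closed Omega0) (Omega0_nonempty : Omega0 !=set0)
    (Omega0_proper : Omega0 <> setT) :
  convex_set Omega0 <->
  (forall c : R, convex_set (sublevel (sdf Omega0) c)).
Proof.
split => [cvx c|/(_ 0)]; first exact: convex_sublevel_sdf.
by rewrite sublevel_sdf0.
Qed.
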